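(* Let $\mathcal{A}_j$ be an optimal active set of the multiparametric quadratic program (mpQP), with parametric solution $\lambda^*(\theta)=\tilde q_j+\tilde Q_j\theta$, $z^*(\theta)=k_j+K_j\theta$. Let $l\in\mathcal{A}_j$ be such that $\mathcal{A}_i=\mathcal{A}_j\setminus\{l\}$ is also an optimal active set, and assume $G_{\mathcal{A}_j}$ (hence $G_{\mathcal{A}_i}$) has full row rank. Let $c_j,v_j,f_j,\tilde d_j$ be the rank-one modification data for adding $l$ to $\mathcal{A}_i$ and define $c_i=c_j$, $v_i=v_j$, $\tilde d_i=-\tilde d_j$, $f_i=-f_j$. Then the parametric solution for $\mathcal{A}_i$ is given, for all $\theta\in\mathbb{R}^n$, by $$\lambda^*(\theta)=\tilde q_i+\tilde Q_i\theta=\tilde q_j+\tilde Q_j\theta-\tilde d_i\,(c_i+v_i^T\theta),$$ $$z^*(\theta)=k_i+K_i\theta=k_j+K_j\theta+f_i\,(c_i+v_i^T\theta).$$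
   Context: Problem (mpQP): for a parameter $\theta\in\Theta\subseteq\mathbb{R}^n$ ($\Theta$ a polyhedral set), minimize $\frac12 z^T H z$ over $z\in\mathbb{R}^m$ subject to $Gz\preceq b+S\theta$, where $H\in\mathbb{R}^{m\times m}$ is symmetric positive definite, $G\in\mathbb{R}^{p\times m}$, $b\in\mathbb{R}^p$, $S\in\mathbb{R}^{p\times n}$, and $\preceq$ is componentwise. Lagrange multipliers of the inequalities are denoted $\lambda\in\mathbb{R}^p$ (KKT conditions: $Hz+G^T\lambda=0$, $Gz\preceq b+S\theta$, $\lambda\succeq0$, complementary slackness). Indexing: for an index set $\mathcal{I}\subseteq\{1,\dots,p\}$, $G_{\mathcal{I}}$, $b_{\mathcal{I}}$, $S_{\mathcal{I}}$ denote the rows indexed by $\mathcal{I}$ (and $G_l,b_l,S_l$ the $l$-th rows, $G_l$ and $S_l$ being row vectors); for indexed quantities such as $\tilde q_i,\tilde Q_i,\tilde d_j$, a second index denotes the corresponding entries or rows, e.g. $\tilde q_{i,\mathcal{I}}$. Optimal active set: a set $\mathcal{A}\subseteq\{1,\dots,p\}$ that, for some $\theta\in\Theta$ for which the problem is feasible, is exactly the set of constraints holding with equality at the optimum, with no weakly active constraints (the multipliers indexed by $\mathcal{A}$ are nonzero). Its complement is $\mathcal{N}=\{1,\dots,p\}\setminus\mathcal{A}$. Optimal active sets are denoted $\mathcal{A}_i$, with complements $\mathcal{N}_i$. Standing assumption (LICQ): $G_{\mathcal{A}_i}$ has full row rank. Parametric solution for $\mathcal{A}_i$: the affine functions $\lambda^*(\theta)=\tilde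 q_i+\tilde Q_i\theta$ and $z^*(\theta)=k_i+K_i\theta$, where $\tilde q_i\in\mathbb{R}^p$, $\tilde Q_i\in\mathbb{R}^{p\times n}$ satisfy $\tilde q_{i,\mathcal{N}_i}=0$, $\tilde Q_{i,\mathcal{N}_i}=0$, $$\tilde q_{i,\mathcal{A}_i}=-(G_{\mathcal{A}_i}H^{-1}G_{\mathcal{A}_i}^T)^{-1}b_{\mathcal{A}_i},\qquad \tilde Q_{i,\mathcal{A}_i}=-(G_{\mathcal{A}_i}H^{-1}G_{\mathcal{A}_i}^T)^{-1}S_{\mathcal{A}_i},$$ and $k_i=-H^{-1}G_{\mathcal{A}_i}^T\tilde q_{i,\mathcal{A}_i}\in\mathbb{R}^m$, $K_i=-H^{-1}G_{\mathcal{A}_i}^T\tilde Q_{i,\mathcal{A}_i}\in\mathbb{R}^{m\times n}$. The same definitions apply with $j$ in place of $i$. (This is the primal-dual solution of minimizing $\frac12z^THz$ subject to $G_{\mathcal{A}_i}z=b_{\mathcal{A}_i}+S_{\mathcal{A}_i}\theta$, and it solves the mpQP for $\theta$ in the critical region of $\mathcal{A}_i$.) When $\mathcal{A}_i=\emptyset$, all these quantities are zero. Rank-one modification data for adding $l$ to $\mathcal{A}_i$ (so $\mathcal{A}_j=\mathcal{A}_i\cup\{l\}$, $l\notin\mathcal{A}_i$): put $W=G_{\mathcal{A}_i}H^{-1}G_{\mathcal{A}_i}^T$, $w=G_{\mathcal{A}_i}H^{-1}G_l^T$, $w_0=G_lH^{-1}G_l^T$, $C=w_0-w^TW^{-1}w>0$,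 and $$c_j=C^{-1}(w^TW^{-1}b_{\mathcal{A}_i}-b_l)\in\mathbb{R},\quad v_j=C^{-1}(S_{\mathcal{A}_i}^TW^{-1}w-S_l^T)\in\mathbb{R}^n,$$ $\tilde d_j\in\mathbb{R}^p$ with $\tilde d_{j,\mathcal{A}_i}=W^{-1}w$, $\tilde d_{j,l}=-1$, $\tilde d_{j,\mathcal{N}_j}=0$, and $f_j=H^{-1}G_{\mathcal{A}_j}^T\tilde d_{j,\mathcal{A}_j}\in\mathbb{R}^m$. If $\mathcal{A}_i=\emptyset$, all terms involving $W$ or $w$ are absent (zero). *)

(* Defs.v *)
From HB Require Import structures.
From mathcomp Require Import all_boot all_order all_algebra.
From mathcomp Require Import reals.

Set Implicit Arguments.
Unset Strict Implicit.
Unset Printing Implicit Defensive.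

Import Order.TTheory GRing.Theory Num.Theory.
Local Open Scope ring_scope.

(* The rows of M indexed by A, in increasing order: M_A.  For A = set0 this is
   a matrix with no rows, so every product through it vanishes. *)
Definition rowsof (R : realType) (p k : nat) (A : {set 'I_p})
    (M : 'M[R]_(p, k)) : 'M[R]_(#|A|, k) :=
  rowsub (@enum_val _ (mem A)) M.

(* The matrix with p rows whose A-rows are M and whose other rows are 0; it is
   characterized by rowsof_fillrows and rowsof_fillrowsC below. *)
Definition fillrows (R : realType) (p k : nat) (A : {set 'I_p})
    (M : 'M[R]_(#|A|, k)) : 'M[R]_(p, k) :=
  \matrix_(i, j) \sum_(a < #|A| | enum_val a == i) M a j.

Lemma rowsof_fillrows (R : realType) (p k : nat) (A : {set 'I_p})
  (M : 'M[R]_(#|A|, k)) : rowsof A (fillrows M) = M.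
Proof.
apply/matrixP=> a j; rewrite !mxE (big_pred1 a) // => a'.
by rewrite (inj_eq enum_val_inj).
Qed.

Lemma rowsof_fillrowsC (R : realType) (p k : nat) (A : {set 'I_p})
  (M : 'M[R]_(#|A|, k)) : rowsof (~: A) (fillrows M) = 0.
Proof.
apply/matrixP=> a j; rewrite !mxE big1 // => a' /eqP e.
by have := enum_valP a; rewrite -e inE enum_valP.
Qed.

Definition vle (R : realType) (k : nat) (x y : 'cV[R]_k) : Prop :=
  forall i, x i 0 <= y i 0.

Definition posdef (R : realType) (m : nat) (H : 'M[R]_m) : Prop :=
  H^T = H /\ forall z : 'cV[R]_m, z != 0 -> 0 < (z^T *m H *m z) 0 0.

Definition polyhedral (R : realType) (n : nat) (Theta : 'cV[R]_n -> Prop)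
    : Prop :=
  exists (r : nat) (E : 'M[R]_(r, n)) (e : 'cV[R]_r),
    forall theta, Theta theta <-> vle (E *m theta) e.

Definition qp_cost (R : realType) (m : nat) (H : 'M[R]_m) (z : 'cV[R]_m) : R :=
  2^-1 * (z^T *m H *m z) 0 0.

Definition qp_feasible (R : realType) (m n p : nat) (G : 'M[R]_(p, m))
    (b : 'cV[R]_p) (S : 'M[R]_(p, n)) (theta : 'cV[R]_n) (z : 'cV[R]_m)
    : Prop :=
  vle (G *m z) (b + S *m theta).

Definition qp_optimal (R : realType) (m n p : nat) (H : 'M[R]_m)
    (G : 'M[R]_(p, m)) (b : 'cV[R]_p) (S : 'M[R]_(p, n)) (theta : 'cV[R]_n)
    (z : 'cV[R]_m) : Prop :=
  qp_feasible G b S theta z /\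
  forall z', qp_feasible G b S theta z' -> qp_cost H z <= qp_cost H z'.

Definition qp_KKT (R : realType) (m n p : nat) (H : 'M[R]_m)
    (G : 'M[R]_(p, m)) (b : 'cV[R]_p) (S : 'M[R]_(p, n)) (theta : 'cV[R]_n)
    (z : 'cV[R]_m) (lambda : 'cV[R]_p) : Prop :=
  [/\ H *m z + G^T *m lambda = 0,
      qp_feasible G b S theta z,
      vle 0 lambda
    & forall i, lambda i 0 * ((G *m z) i 0 - (b + S *m theta) i 0) = 0].

(* When G_A has full row rank the multiplier lambda is unique, so quantifying
   it existentially is not a choice. *)
Definition optimal_active_set (R : realType) (m n p : nat) (H : 'M[R]_m)
    (G : 'M[R]_(p, m)) (b : 'cV[R]_p) (S : 'M[R]_(p, n))
    (Theta : 'cV[R]_n -> Prop) (A : {set 'I_p}) : Prop :=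
  exists (theta : 'cV[R]_n) (z : 'cV[R]_m) (lambda : 'cV[R]_p),
    [/\ Theta theta,
        qp_optimal H G b S theta z,
        A = [set i | (G *m z) i 0 == (b + S *m theta) i 0],
        qp_KKT H G b S theta z lambda
      & forall i, i \in A -> lambda i 0 != 0].

Definition Wmx (R : realType) (m p : nat) (H : 'M[R]_m) (G : 'M[R]_(p, m))
    (A : {set 'I_p}) : 'M[R]_#|A| :=
  rowsof A G *m invmx H *m (rowsof A G)^T.

Definition sol_q (R : realType) (m p : nat) (H : 'M[R]_m) (G : 'M[R]_(p, m))
    (b : 'cV[R]_p) (A : {set 'I_p}) : 'cV[R]_p :=
  fillrows (- (invmx (Wmx H G A) *m rowsof A b)).

Definition sol_Q (R : realType) (m n p : nat) (H : 'M[R]_m)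
    (G : 'M[R]_(p, m)) (S : 'M[R]_(p, n)) (A : {set 'I_p}) : 'M[R]_(p, n) :=
  fillrows (- (invmx (Wmx H G A) *m rowsof A S)).

Definition sol_k (R : realType) (m p : nat) (H : 'M[R]_m) (G : 'M[R]_(p, m))
    (b : 'cV[R]_p) (A : {set 'I_p}) : 'cV[R]_m :=
  - (invmx H *m (rowsof A G)^T *m rowsof A (sol_q H G b A)).

Definition sol_K (R : realType) (m n p : nat) (H : 'M[R]_m)
    (G : 'M[R]_(p, m)) (S : 'M[R]_(p, n)) (A : {set 'I_p}) : 'M[R]_(m, n) :=
  - (invmx H *m (rowsof A G)^T *m rowsof A (sol_Q H G S A)).

(* Rank-one modification data for adding l to A, meaningful when l \notin A. *)
Definition r1_w (R : realType) (m p : nat) (H : 'M[R]_m) (G : 'M[R]_(p, m))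
    (A : {set 'I_p}) (l : 'I_p) : 'cV[R]_#|A| :=
  rowsof A G *m invmx H *m (row l G)^T.

Definition r1_C (R : realType) (m p : nat) (H : 'M[R]_m) (G : 'M[R]_(p, m))
    (A : {set 'I_p}) (l : 'I_p) : R :=
  (row l G *m invmx H *m (row l G)^T) 0 0
  - ((r1_w H G A l)^T *m invmx (Wmx H G A) *m r1_w H G A l) 0 0.

Definition r1_c (R : realType) (m p : nat) (H : 'M[R]_m) (G : 'M[R]_(p, m))
    (b : 'cV[R]_p) (A : {set 'I_p}) (l : 'I_p) : R :=
  (r1_C H G A l)^-1 *
  (((r1_w H G A l)^T *m invmx (Wmx H G A) *m rowsof A b) 0 0 - b l 0).

Definition r1_v (R : realType) (m n p : nat) (H : 'M[R]_m)
    (G : 'M[R]_(p, m)) (S : 'M[R]_(p, n)) (A : {set 'I_p}) (l : 'I_p)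
    : 'cV[R]_n :=
  (r1_C H G A l)^-1 *:
  ((rowsof A S)^T *m invmx (Wmx H G A) *m r1_w H G A l - (row l S)^T).

Definition r1_d (R : realType) (m p : nat) (H : 'M[R]_m) (G : 'M[R]_(p, m))
    (A : {set 'I_p}) (l : 'I_p) : 'cV[R]_p :=
  \col_i if i == l then -1
         else fillrows (invmx (Wmx H G A) *m r1_w H G A l) i 0.

Definition r1_f (R : realType) (m p : nat) (H : 'M[R]_m) (G : 'M[R]_(p, m))
    (A : {set 'I_p}) (l : 'I_p) : 'cV[R]_m :=
  invmx H *m (rowsof (l |: A) G)^T *m rowsof (l |: A) (r1_d H G A l).

(* Main.v *)
Require Import Defs.
From HB Require Import structures.
From mathcomp Require Import all_boot all_order all_algebra.
From mathcomp Require Import reals.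

Set Implicit Arguments.
Unset Strict Implicit.
Unset Printing Implicit Defensive.

Import Order.TTheory GRing.Theory Num.Theory.
Local Open Scope ring_scope.

(* For beta = b + S theta, the multiplier of the equality-constrained problem
   on A is the unique vector x supported on A whose image under the dual Hessian
   M = G H^-1 G^T agrees with - beta on A.  The vector d is supported on
   Aj = l |: Ai, and M d vanishes on Ai and equals - C at l; hence subtracting
   t d from the multiplier of Ai leaves the Ai-equations unchanged, and
   t = c + v^T theta is the value for which the l-equation holds as well.  So
   the result is the multiplier of Aj.  Here C = d^T M d is positive because G^T
   is injective on vectors supported on Aj. *)

(** * Positive definite matrices *)

Lemma posdef_unitmx (R : realType) (m : nat) (H : 'M[R]_m) :
  posdef H -> H \in unitmx.
Proof.
move=> [Hs Hp]; rewrite -row_free_unit -kermx_eq0; apply/eqP/row_matrixP=> i.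
rewrite row0; set u := row i _.
have uH : u *m H = 0 by rewrite -row_mul mulmx_ker row0.
apply/eqP; apply/negPn/negP=> u0.
(* A nonzero left kernel vector u would make the quadratic form of [H] vanish at [u^T]. *)
have := Hp u^T; rewrite trmxK uH mul0mx mxE ltxx => /(_ _)/negP.
by apply=> //; rewrite trmx_eq0.
Qed.

(** Evaluating the form of [H] at [invmx H *m z] gives the form of [invmx H] at z. *)
Lemma posdef_invmx (R : realType) (m : nat) (H : 'M[R]_m) :
  posdef H -> posdef (invmx H).
Proof.
move=> Hpd; have Hu := posdef_unitmx Hpd; case: Hpd => Hs Hp.
have Is : (invmx H)^T = invmx H by rewrite trmx_inv Hs.
split=> // z z0.
have := Hp (invmx H *m z).
rewrite trmx_mul Is -!mulmxA (mulmxA H) mulmxV // mul1mx; apply.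
by apply: contraNneq z0 => e; rewrite -(mulKVmx Hu z) e mulmx0.
Qed.

Lemma posdef_congr (R : realType) (k m : nat) (K : 'M[R]_m)
    (L : 'M[R]_(k, m)) :
  posdef K -> row_free L -> posdef (L *m K *m L^T).
Proof.
move=> [Ks Kp] Lf; split=> [|z z0]; first by rewrite !trmx_mul trmxK Ks mulmxA.
have := Kp (L^T *m z); rewrite trmx_mul trmxK !mulmxA; apply.
apply: contraNneq z0 => e; rewrite -trmx_eq0 -(mulmx_free_eq0 _ Lf).
by rewrite -[L]trmxK -trmx_mul e trmx0.
Qed.

(** * Selecting rows and filling with zeros *)

Lemma rowsofE (R : realType) (p k : nat) (A : {set 'I_p}) (M : 'M[R]_(p, k)) :
  rowsof A M = rowsof A 1%:M *m M.
Proof. by rewrite /rowsof mul_rowsub_mx mul1mx. Qed.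

Lemma rowsofP (R : realType) (p k : nat) (A : {set 'I_p})
    (M N : 'M[R]_(p, k)) :
  rowsof A M = rowsof A N <-> forall i, i \in A -> row i M = row i N.
Proof.
split=> [e i iA|e].
  apply/rowP=> j; rewrite !mxE; have /matrixP/(_ (enum_rank_in iA i) j) := e.
  by rewrite !mxE enum_rankK_in.
by apply/row_matrixP=> a; rewrite !row_rowsub e // enum_valP.
Qed.

Lemma rowsofD (R : realType) (p k : nat) (A : {set 'I_p})
    (M N : 'M[R]_(p, k)) :
  rowsof A (M + N) = rowsof A M + rowsof A N.
Proof. by apply/matrixP=> a j; rewrite !mxE. Qed.

Lemma rowsofM (R : realType) (p k n : nat) (A : {set 'I_p})
    (M : 'M[R]_(p, k)) (N : 'M[R]_(k, n)) :
  rowsof A (M *m N) = rowsof A M *m N.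
Proof. by rewrite rowsofE mulmxA -rowsofE. Qed.

(** Filling is the adjoint of selecting: both are products with the same selection matrix, so matrix
    associativity handles them. *)
Lemma fillrowsE (R : realType) (p k : nat) (A : {set 'I_p})
    (M : 'M[R]_(#|A|, k)) :
  fillrows M = (rowsof A 1%:M)^T *m M.
Proof.
apply/matrixP=> i j; rewrite !mxE big_mkcond; apply: eq_bigr => a _.
by rewrite !mxE; case: eqP => _; rewrite ?mul1r ?mul0r.
Qed.

Lemma fillrows_out (R : realType) (p k : nat) (A : {set 'I_p})
    (M : 'M[R]_(#|A|, k)) i j :
  i \notin A -> fillrows M i j = 0.
Proof.
move=> iA; rewrite mxE big1 // => a /eqP e.
by rewrite -e enum_valP in iA.
Qed.

Lemma fillrowsK (R : realType) (p k : nat) (A : {set 'I_p})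
    (M : 'M[R]_(p, k)) :
  (forall i j, i \notin A -> M i j = 0) -> fillrows (rowsof A M) = M.
Proof.
move=> M0; apply/matrixP=> i j.
case: (boolP (i \in A)) => iA; last by rewrite fillrows_out // M0.
have /rowsofP/(_ i iA)/rowP/(_ j) := rowsof_fillrows (rowsof A M).
by rewrite !mxE.
Qed.

Lemma trmx_rowsof_mul (R : realType) (p m k : nat) (A : {set 'I_p})
    (G : 'M[R]_(p, m)) (M : 'M[R]_(#|A|, k)) :
  (rowsof A G)^T *m M = G^T *m fillrows M.
Proof. by rewrite rowsofE trmx_mul fillrowsE mulmxA. Qed.

(** A vector supported on A is the filling of its own restriction, and full row rank of [rowsof A G]
    makes its transpose injective. *)
Lemma row_free_rowsof_inj (R : realType) (p m : nat) (A : {set 'I_p})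
    (G : 'M[R]_(p, m)) (x : 'cV[R]_p) :
  row_free (rowsof A G) -> (forall i j, i \notin A -> x i j = 0) ->
  G^T *m x = 0 -> x = 0.
Proof.
move=> Gf x0 Gx; rewrite -(fillrowsK x0); suff -> : rowsof A x = 0.
  by rewrite fillrowsE mulmx0.
apply/eqP; rewrite -trmx_eq0 -(mulmx_free_eq0 _ Gf) -trmx_eq0.
by rewrite trmx_mul trmxK trmx_rowsof_mul fillrowsK // Gx.
Qed.

(** A left kernel vector of [rowsof A G], extended by zero, is supported on B and killed by
    [G^T]. *)
Lemma row_free_rowsof_sub (R : realType) (p m : nat) (A B : {set 'I_p})
    (G : 'M[R]_(p, m)) :
  A \subset B -> row_free (rowsof B G) -> row_free (rowsof A G).
Proof.
move=> sAB Gf; rewrite -kermx_eq0; apply/eqP/row_matrixP=> i.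
rewrite row0; set u := row i _.
have uG : u *m rowsof A G = 0 by rewrite -row_mul mulmx_ker row0.
have : fillrows u^T = 0.
  apply: (row_free_rowsof_inj Gf) => [k j kB|].
    by apply: fillrows_out; apply: contraNN kB; apply: (subsetP sAB).
  by rewrite -trmx_rowsof_mul -trmx_mul uG trmx0.
move=> u0; apply: trmx_inj; rewrite -(rowsof_fillrows u^T) u0.
by rewrite rowsofE mulmx0 trmx0.
Qed.

(** * The dual Hessian and the multiplier on a fixed active set *)

Definition dual_hess (R : realType) (m p : nat) (H : 'M[R]_m)
    (G : 'M[R]_(p, m)) : 'M[R]_p := G *m invmx H *m G^T.

(** [Wmx] is the A-by-A block of [dual_hess]. Equations for different active sets thus become
    equations between vectors of the common length p. *)
Lemma rowsof_dual_hess (R : realType) (m p k : nat) (H : 'M[R]_m)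
    (G : 'M[R]_(p, m)) (A : {set 'I_p}) (M : 'M[R]_(#|A|, k)) :
  rowsof A (dual_hess H G *m fillrows M) = Wmx H G A *m M.
Proof. by rewrite /dual_hess /Wmx -!mulmxA trmx_rowsof_mul rowsofM. Qed.

Lemma Wmx_posdef (R : realType) (m p : nat) (H : 'M[R]_m) (G : 'M[R]_(p, m))
    (A : {set 'I_p}) :
  posdef H -> row_free (rowsof A G) -> posdef (Wmx H G A).
Proof. by move=> /posdef_invmx; apply: posdef_congr. Qed.

Lemma sol_q_unique (R : realType) (m p : nat) (H : 'M[R]_m)
    (G : 'M[R]_(p, m)) (b : 'cV[R]_p) (A : {set 'I_p}) (x : 'cV[R]_p) :
  posdef H -> row_free (rowsof A G) -> (forall i j, i \notin A -> x i j = 0) ->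
  (forall i, i \in A -> (dual_hess H G *m x) i 0 = - b i 0) ->
  x = sol_q H G b A.
Proof.
move=> Hpd Gf x0 e; have Wu := posdef_unitmx (Wmx_posdef Hpd Gf).
rewrite /sol_q -[LHS](fillrowsK x0); congr fillrows.
rewrite -mulmxN -[LHS](mulKmx Wu); congr (_ *m _).
rewrite -rowsof_dual_hess fillrowsK //.
by apply/matrixP=> a j; rewrite [LHS]mxE ord1 e ?enum_valP // !mxE.
Qed.

Lemma dual_hess_sol_q (R : realType) (m p : nat) (H : 'M[R]_m)
    (G : 'M[R]_(p, m)) (b : 'cV[R]_p) (A : {set 'I_p}) i :
  posdef H -> row_free (rowsof A G) -> i \in A ->
  (dual_hess H G *m sol_q H G b A) i 0 = - b i 0.
Proof.
move=> Hpd Gf iA; have Wu := posdef_unitmx (Wmx_posdef Hpd Gf).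
have := rowsof_dual_hess H G (- (invmx (Wmx H G A) *m rowsof A b)).
rewrite mulmxN mulKVmx //.
have -> : - rowsof A b = rowsof A (- b) by apply/matrixP=> ? ?; rewrite !mxE.
by move/rowsofP/(_ i iA)/rowP/(_ 0); rewrite !mxE.
Qed.

(** By symmetry of [invmx H], the row l of [dual_hess] restricted to the columns in A is the
    transpose of w. *)
Lemma dual_hess_fillrows_row (R : realType) (m p : nat) (H : 'M[R]_m)
    (G : 'M[R]_(p, m)) (A : {set 'I_p}) (l : 'I_p) (y : 'cV[R]_#|A|) :
  posdef H ->
  (dual_hess H G *m fillrows y) l 0 = ((r1_w H G A l)^T *m y) 0 0.
Proof.
move=> /posdef_invmx [Hs _].
have -> : (r1_w H G A l)^T *m y = row l (dual_hess H G *m fillrows y).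
  rewrite /r1_w /dual_hess !trmx_mul trmxK Hs -!mulmxA trmx_rowsof_mul.
  by rewrite row_mul.
by rewrite [RHS]mxE.
Qed.

(** * The rank-one direction d *)

Lemma r1_dE (R : realType) (m p : nat) (H : 'M[R]_m) (G : 'M[R]_(p, m))
    (A : {set 'I_p}) (l : 'I_p) :
  l \notin A ->
  r1_d H G A l
    = fillrows (invmx (Wmx H G A) *m r1_w H G A l) - delta_mx l 0.
Proof.
move=> lA; apply/colP=> i; rewrite [LHS]mxE [RHS]mxE.
rewrite [X in _ + X]mxE [X in _ - X]mxE andbT.
case: eqP => [->|_]; last by rewrite subr0.
by rewrite fillrows_out // sub0r.
Qed.

(** On A, the filled part of d contributes W W^-1 w = w, and the column l of [dual_hess] is also w
    there. *)
Lemma dual_hess_r1_d (R : realType) (m p : nat) (H : 'M[R]_m)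
    (G : 'M[R]_(p, m)) (A : {set 'I_p}) (l i : 'I_p) :
  posdef H -> row_free (rowsof A G) -> l \notin A -> i \in A ->
  (dual_hess H G *m r1_d H G A l) i 0 = 0.
Proof.
move=> Hpd Gf lA iA; have Wu := posdef_unitmx (Wmx_posdef Hpd Gf).
suff /rowsofP/(_ i iA)/rowP/(_ 0) :
    rowsof A (dual_hess H G *m r1_d H G A l) = rowsof A 0 by rewrite !mxE.
rewrite r1_dE // mulmxBr rowsofE mulmxBr -!rowsofE rowsof_dual_hess.
rewrite mulKVmx // [in RHS]rowsofE mulmx0.
by rewrite /r1_w tr_row colE /dual_hess -!mulmxA !rowsofM subrr.
Qed.

Lemma dual_hess_r1_d_l (R : realType) (m p : nat) (H : 'M[R]_m)
    (G : 'M[R]_(p, m)) (A : {set 'I_p}) (l : 'I_p) :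
  posdef H -> l \notin A ->
  (dual_hess H G *m r1_d H G A l) l 0 = - r1_C H G A l.
Proof.
move=> Hpd lA; rewrite r1_dE // mulmxBr [LHS]mxE [X in _ + X]mxE.
rewrite dual_hess_fillrows_row //.
rewrite /r1_C opprB mulmxA; congr (_ - _).
by rewrite tr_row colE mulmxA -!row_mul [RHS]mxE.
Qed.

Lemma r1_C_gt0 (R : realType) (m p : nat) (H : 'M[R]_m) (G : 'M[R]_(p, m))
    (A : {set 'I_p}) (l : 'I_p) :
  posdef H -> row_free (rowsof (l |: A) G) -> l \notin A ->
  0 < r1_C H G A l.
Proof.
move=> Hpd Gf lA; set d := r1_d H G A l.
have GAf := row_free_rowsof_sub (subsetUr _ _) Gf.
have dl : d l 0 = -1 by rewrite mxE eqxx.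
have d0 i j : i \notin l |: A -> d i j = 0.
  rewrite in_setU1 negb_or mxE => /andP[/negPf-> iA].
  by rewrite fillrows_out.
(* Only the index l contributes to this product: [dual_hess H G *m d] vanishes on A, and d vanishes
   outside [l |: A]. *)
have -> : r1_C H G A l = (d^T *m (dual_hess H G *m d)) 0 0.
  rewrite mxE (bigD1 l) //= big1 => [|i il].
    by rewrite dual_hess_r1_d_l // mxE dl mulrNN mul1r addr0.
  case: (boolP (i \in A)) => iA; first by rewrite dual_hess_r1_d // mulr0.
  by rewrite mxE d0 ?mul0r // in_setU1 negb_or il.
have [_ Hp] := posdef_invmx Hpd.
have := Hp (G^T *m d); rewrite trmx_mul trmxK /dual_hess !mulmxA; apply.
(* If [G^T *m d] were zero, d would be zero, against its entry -1 at l. *)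
apply/eqP => /(row_free_rowsof_inj Gf d0) /colP /(_ l).
by rewrite dl mxE => /eqP; rewrite oppr_eq0 oner_eq0.
Qed.

Lemma sol_q_setU1 (R : realType) (m p : nat) (H : 'M[R]_m)
    (G : 'M[R]_(p, m)) (b : 'cV[R]_p) (A : {set 'I_p}) (l : 'I_p) :
  posdef H -> row_free (rowsof (l |: A) G) -> l \notin A ->
  sol_q H G b A - r1_c H G b A l *: r1_d H G A l = sol_q H G b (l |: A).
Proof.
move=> Hpd Gf lA; have GAf := row_free_rowsof_sub (subsetUr _ _) Gf.
have C0 : r1_C H G A l != 0 by rewrite gt_eqF // r1_C_gt0.
(* It remains to check the support, then the equations at l and on A. *)
apply: sol_q_unique => // [i j|i].
  rewrite in_setU1 negb_or => /andP[/negPf il iA].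
  rewrite mxE fillrows_out // 3!mxE il fillrows_out // mulr0.
  by rewrite oppr0 addr0.
rewrite in_setU1 mulmxBr -scalemxAr => iA.
rewrite [LHS]mxE [X in _ + X]mxE [X in _ - X]mxE.
case/predU1P: iA => [->|iA]; last first.
  by rewrite dual_hess_sol_q // dual_hess_r1_d // mulr0 subr0.
(* At l the two terms are - w^T W^-1 b_A and c C = w^T W^-1 b_A - b_l, which add up to - b_l. *)
rewrite dual_hess_r1_d_l // /sol_q dual_hess_fillrows_row // mulmxN.
rewrite [X in X - _]mxE mulmxA /r1_c mulrN opprK mulrAC mulVf // mul1r.
by rewrite addrA addNr sub0r.
Qed.

(** * The primal solution and the dependence on theta *)

(** This is stationarity, z = - H^-1 G^T lambda; the matrix applied to the full-length multiplier
    does not depend on A. *)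
Lemma sol_kE (R : realType) (m p : nat) (H : 'M[R]_m) (G : 'M[R]_(p, m))
    (b : 'cV[R]_p) (A : {set 'I_p}) :
  sol_k H G b A = - (invmx H *m G^T *m sol_q H G b A).
Proof.
by rewrite /sol_k rowsof_fillrows -!mulmxA trmx_rowsof_mul.
Qed.

Lemma r1_fE (R : realType) (m p : nat) (H : 'M[R]_m) (G : 'M[R]_(p, m))
    (A : {set 'I_p}) (l : 'I_p) :
  r1_f H G A l = invmx H *m G^T *m r1_d H G A l.
Proof.
rewrite /r1_f -!mulmxA trmx_rowsof_mul fillrowsK // => i j.
rewrite in_setU1 negb_or mxE => /andP[/negPf-> iA].
by rewrite fillrows_out.
Qed.

(** The multiplier is linear in the right-hand side, so theta is absorbed into beta = b + S
    theta. *)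
Lemma sol_qD (R : realType) (m n p : nat) (H : 'M[R]_m) (G : 'M[R]_(p, m))
    (b : 'cV[R]_p) (S : 'M[R]_(p, n)) (A : {set 'I_p}) (theta : 'cV[R]_n) :
  sol_q H G b A + sol_Q H G S A *m theta = sol_q H G (b + S *m theta) A.
Proof.
rewrite /sol_q /sol_Q rowsofD rowsofM !fillrowsE -!mulmxA -mulmxDr.
by rewrite mulNmx -opprD mulmxDr mulmxA.
Qed.

Lemma sol_kD (R : realType) (m n p : nat) (H : 'M[R]_m) (G : 'M[R]_(p, m))
    (b : 'cV[R]_p) (S : 'M[R]_(p, n)) (A : {set 'I_p}) (theta : 'cV[R]_n) :
  sol_k H G b A + sol_K H G S A *m theta = sol_k H G (b + S *m theta) A.
Proof.
rewrite /sol_k /sol_K -sol_qD rowsofD rowsofM mulmxDr opprD.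
by rewrite mulNmx mulmxA.
Qed.

Lemma r1_cD (R : realType) (m n p : nat) (H : 'M[R]_m) (G : 'M[R]_(p, m))
    (b : 'cV[R]_p) (S : 'M[R]_(p, n)) (A : {set 'I_p}) (l : 'I_p)
    (theta : 'cV[R]_n) :
  posdef H ->
  r1_c H G b A l + ((r1_v H G S A l)^T *m theta) 0 0
    = r1_c H G (b + S *m theta) A l.
Proof.
move=> Hpd; have [Hs _] := posdef_invmx Hpd.
(* [r1_v] is a column, and transposing it yields w^T W^-1 S_A by symmetry of W^-1. *)
have Ws : (invmx (Wmx H G A))^T = invmx (Wmx H G A).
  by rewrite trmx_inv /Wmx !trmx_mul trmxK Hs mulmxA.
rewrite /r1_c /r1_v linearZ /= -scalemxAl [X in _ + X]mxE -mulrDr.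
congr (_ * _); rewrite linearB /= !trmx_mul !trmxK Ws mulmxBl.
rewrite rowsofD rowsofM mulmxDr !mulmxA.
set X := _ *m rowsof A b; set Y := _ *m theta.
have -> : (Y - row l S *m theta) 0 0 = Y 0 0 - (S *m theta) l 0.
  by rewrite -row_mul !mxE.
by rewrite [(X + Y) 0 0]mxE [(b + _) l 0]mxE opprD addrACA.
Qed.

Theorem theorem2 (R : realType) (m n p : nat)
    (H : 'M[R]_m) (G : 'M[R]_(p, m)) (b : 'cV[R]_p) (S : 'M[R]_(p, n))
    (Theta : 'cV[R]_n -> Prop) (Ai Aj : {set 'I_p}) (l : 'I_p)
    (H_posdef : posdef H)
    (Theta_polyhedral : polyhedral Theta)
    (Aj_optimal : optimal_active_set H G b S Theta Aj)
    (l_in_Aj : l \in Aj)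
    (Ai_def : Ai = Aj :\ l)
    (Ai_optimal : optimal_active_set H G b S Theta Ai)
    (GAj_full_row_rank : row_free (rowsof Aj G)) :
  let ci := r1_c H G b Ai l in
  let vi := r1_v H G S Ai l in
  let di := - r1_d H G Ai l in
  let fi := - r1_f H G Ai l in
  forall theta : 'cV[R]_n,
    sol_q H G b Ai + sol_Q H G S Ai *m theta
      = sol_q H G b Aj + sol_Q H G S Aj *m theta
        - (ci + (vi^T *m theta) 0 0) *: di
    /\
    sol_k H G b Ai + sol_K H G S Ai *m theta
      = sol_k H G b Aj + sol_K H G S Aj *m theta
        + (ci + (vi^T *m theta) 0 0) *: fi.
Proof.
move=> ci vi di fi theta; rewrite !sol_qD !sol_kD r1_cD //.
have lAi : l \notin Ai by rewrite Ai_def !inE eqxx.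
have Aj_def : Aj = l |: Ai by rewrite Ai_def setD1K.
move: GAj_full_row_rank; rewrite {}Aj_def => Gf.
have qE := sol_q_setU1 (b + S *m theta) H_posdef Gf lAi.
(* Writing the multiplier of [Aj] through that of [Ai] makes the correction terms cancel, because
   [di] and [fi] carry the opposite sign. *)
rewrite !sol_kE /fi r1_fE -qE /di; split; first by rewrite !scalerN opprK subrK.
by rewrite mulmxBr -scalemxAr opprB scalerN addrAC subrr add0r.
Qed.
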